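(* Suppose that for every $\alpha<1/2$ there exists a constant $C_\alpha$ such that for all $N\ge 0$ and all positive integers $n$, $$\#\{(a,b)\in\mathbb{Z}^2:\ a^2+b^2=n,\ N\le |b|<N+n^{\alpha}\}\le C_\alpha .$$ Then for every $\alpha<1$ there exists a constant $K_\alpha$ such that for every positive integer $N$ and every trigonometric polynomial $f$ of the form $f(\theta)=\sum_{N\le k\le N+N^{\alpha}}a_k e(k^2\theta)$ (with $k$ ranging over integers and $a_k\in\mathbb{C}$), one has $\|f\|_4\le K_\alpha\|f\|_2$.
   Context: $e(\theta)=e^{2\pi i\theta}$; for a trigonometric polynomial $f$, $\|f\|_p^p=\int_0^1|f(t)|^p\,dt$. *)

(* Defs.v *)
From HB Require Import structures.
From mathcomp Require Import all_boot all_order all_algebra finmap.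
From mathcomp Require Import all_classical all_reals all_analysis.
From mathcomp Require Export complex.
Set Implicit Arguments.
Unset Strict Implicit.
Unset Printing Implicit Defensive.
Import Order.TTheory GRing.Theory Num.Theory.
Local Open Scope classical_set_scope.
Local Open Scope ring_scope.

(* e(theta) = exp (2 pi i theta), through Euler's formula. *)
Definition expi {R : realType} (theta : R) : R[i] :=
  (cos (2 * pi * theta) +i* sin (2 * pi * theta))%C.

(* The L^p norm on [0, 1] of a complex-valued function; the library's [Lnorm]
   integrates extended-real-valued functions over a whole measurable type. *)
Definition Lpnorm01 {R : realType} (p : R) (f : R -> R[i]) : \bar R :=
  ((\int[lebesgue_measure]_(t in `[0%R, 1%R]) (ComplexField.Normc.normc (f t) `^ p)%:E)
     `^ p^-1)%E.

(* Finite for every n, so [fset_set] does not collapse it to the empty set.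
   An integer N loses nothing over a real one: |b| is an integer, so rounding
   N up can only enlarge the set. *)
Definition arc_points {R : realType} (alpha : R) (N n : nat) : set (int * int) :=
  [set ab | ab.1 ^+ 2 + ab.2 ^+ 2 = n%:Z /\
            (N%:R : R) <= `|ab.2|%:~R < N%:R + n%:R `^ alpha].

(* The index set is finite, so the finitely supported sum is the actual sum. *)
Definition short_squares_poly {R : realType} (alpha : R) (N : nat)
    (a : int -> R[i]) (theta : R) : R[i] :=
  \sum_(k \in [set k : int | (N%:R : R) <= k%:~R <= N%:R + N%:R `^ alpha])
    a k * expi ((k ^+ 2)%:~R * theta).

(* Main.v *)
(* Expanding |g|^2 for g(t) = sum_i c_i e(m_i t) and integrating, only the pairs
   with m_i = m_j survive, and Re (c_i conj c_j) <= (|c_i|^2 + |c_j|^2) / 2 gives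
   ||g||_2^2 <= C sum_i |c_i|^2 as soon as each frequency is taken at most C
   times.  For g = f^2 the frequencies are the j^2 + k^2 with j, k in the window
   [N, N + N^alpha]; a frequency n exceeds N^2, so the window lies in
   [N, N + n^beta) once 2 beta >= alpha, and the hypothesis at such a
   beta < 1/2 bounds the multiplicities.  Hence ||f||_4^4 <= C (sum_k |a_k|^2)^2,
   where sum_k |a_k|^2 = ||f||_2^2 because squaring is injective on k > 0. *)

Require Import Defs.
From HB Require Import structures.
From mathcomp Require Import all_boot all_order all_algebra finmap.
From mathcomp Require Import all_classical all_reals all_analysis.
From mathcomp Require Import ring lra zify.
Import Order.TTheory GRing.Theory Num.Theory.
Import numFieldNormedType.Exports.
Import ComplexField.Normc.
Local Open Scope classical_set_scope.
Local Open Scope ring_scope.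

(** * Characters of the circle and their integrals over [0, 1] *)

Section Exponentials.
Variable R : realType.
Implicit Types (x y t : R) (c z : R[i]) (m : int).

Lemma expiD x y : expi (x + y) = expi x * expi y.
Proof.
rewrite /expi !mulrDr cosD sinD.
by apply/eqP; rewrite eq_complex /= eqxx addrC eqxx.
Qed.

Lemma expi0 : expi (0 : R) = 1.
Proof. by rewrite /expi !mulr0 cos0 sin0. Qed.

Lemma conjc_expi x : ((expi x)^*)%C = expi (- x).
Proof. by rewrite /expi mulrN cosN sinN. Qed.

Lemma expi_nat n : expi (n%:R : R) = 1.
Proof.
elim: n => [|n IHn]; first exact: expi0.
rewrite -natr1 expiD IHn mul1r /expi mulr1.
by rewrite mulr_natl cos2pi sin2pi.
Qed.

Lemma expi_int m : expi (m%:~R : R) = 1.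
Proof.
case: m => n; first exact: expi_nat.
by rewrite NegzE mulrNz -conjc_expi expi_nat conjc1.
Qed.

Lemma continuous_Re_expi c x : continuous (fun t : R => complex.Re (c * expi (x * t))).
Proof.
case: c => a b t /=; apply: cvgB; apply: cvgM; try exact: cvg_cst.
- apply: (@continuous_comp _ _ _ (fun t => 2 * pi * (x * t)) (@cos R)).
    by do 2 (apply: cvgM; first exact: cvg_cst).
  exact: continuous_cos.
- apply: (@continuous_comp _ _ _ (fun t => 2 * pi * (x * t)) (@sin R)).
    by do 2 (apply: cvgM; first exact: cvg_cst).
  exact: continuous_sin.
Qed.

(** The factor [0 +i* (2 * pi * x)] is 2 pi i x. Taking real parts keeps the calculus over the
    reals, where the fundamental theorem applies. *)
Lemma is_derive_Re_expi c x t :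
  is_derive t 1 (fun t : R => complex.Re (c * expi (x * t)))
    (complex.Re (c * (0 +i* (2 * pi * x))%C * expi (x * t))).
Proof.
have lin : is_derive t 1 (fun t => 2 * pi * (x * t)) (2 * pi * x).
  rewrite (_ : (fun t => _) = (fun t => (2 * pi * x) *: t)); last first.
    by apply/funext => u; rewrite /GRing.scale /= mulrA.
  by apply: is_derive_eq; rewrite /GRing.scale /= mulr1.
have dc := @is_derive1_comp _ _ (fun t => 2 * pi * (x * t)) _ _ _
  (is_derive_cos _) lin.
have ds := @is_derive1_comp _ _ (fun t => 2 * pi * (x * t)) _ _ _
  (is_derive_sin _) lin.
case: c => a b.
rewrite (_ : (fun t => _) = a *: (@cos R \o (fun t => 2 * pi * (x * t)))
   - b *: (@sin R \o (fun t => 2 * pi * (x * t)))); last by apply/funext.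
apply: is_derive_eq.
rewrite /GRing.scale /=; ring.
Qed.

Lemma integral_Re_expi c m :
  (\int[lebesgue_measure]_(t in `[0%R, 1%R])
     (complex.Re (c * expi (m%:~R * t)))%:E)%E =
  ((if m == 0 then complex.Re c else 0)%:E)%E.
Proof.
case: eqP => [->|/eqP m0].
  under eq_integral do rewrite mul0r expi0 mulr1.
  rewrite integral_cst//= -[RHS]mule1; congr (_ * _)%E.
  by apply: etrans (lebesgue_measure_itv _) _; rewrite /= lte01 oppr0 adde0.
(* Dividing the coefficient by d = 2 pi i m gives an antiderivative, which takes equal values at 0
   and 1 because m is an integer. *)
pose d : R[i] := (0 +i* (2 * pi * m%:~R))%C.
have d0 : d != 0.
  rewrite eq_complex /= eqxx /= !mulf_eq0 intr_eq0 pnatr_eq0 (negPf m0).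
  by rewrite (gt_eqF (pi_gt0 R)).
pose F t := complex.Re (c / d * expi (m%:~R * t)).
have dF t : is_derive t 1 F (complex.Re (c * expi (m%:~R * t))).
  by have := is_derive_Re_expi (c / d) m%:~R t; rewrite -/d divfK.
rewrite (@continuous_FTC2 _ _ F) //.
- by rewrite /F mulr1 mulr0 expi_int expi0 -EFinB subrr.
- exact/continuous_subspaceT/continuous_Re_expi.
- split => [t _||]; first by apply: ex_derive.
  + exact/cvg_at_right_filter/continuous_Re_expi.
  + exact/cvg_at_left_filter/continuous_Re_expi.
- by move=> t _; rewrite derive1E; apply: derive_val.
Qed.

Lemma integral_sum_Re_expi (I : Type) (s : seq I) (c : I -> R[i]) (m : I -> int) :
  (\int[lebesgue_measure]_(t in `[0%R, 1%R])
     (\sum_(i <- s) complex.Re (c i * expi ((m i)%:~R * t)))%:E)%E =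
  ((\sum_(i <- s | m i == 0) complex.Re (c i))%:E)%E.
Proof.
under eq_integral do rewrite -sumEFin.
rewrite integral_sum //.
  by under eq_bigr do rewrite integral_Re_expi; rewrite sumEFin -big_mkcond.
move=> i; apply: (@continuous_compact_integrable _
  (fun t => complex.Re (c i * expi ((m i)%:~R * t)))).
- exact: segment_compact.
- exact/continuous_subspaceT/continuous_Re_expi.
Qed.

(** * Mean squares of exponential sums *)

Lemma sqr_normcE z : normc z ^+ 2 = complex.Re (z * (z^*)%C).
Proof.
case: z => a b; rewrite /normc sqr_sqrtr ?addr_ge0 ?sqr_ge0 //=.
by rewrite mulrN opprK !expr2.
Qed.

Lemma normc_ge0 z : 0 <= normc z.
Proof. by case: z => a b; rewrite sqrtr_ge0. Qed.

(** Conjugation negates frequencies, so the pair (i, j) contributes the frequency [m i - m j].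
    Frequencies may repeat, as those of f^2 do. *)
Lemma integral_sqr_normc (I : Type) (s : seq I) (c : I -> R[i]) (m : I -> int) :
  (\int[lebesgue_measure]_(t in `[0%R, 1%R])
     (normc (\sum_(i <- s) c i * expi ((m i)%:~R * t)) ^+ 2)%:E)%E =
  ((\sum_(i <- s) \sum_(j <- s | m i == m j)
      complex.Re (c i * ((c j)^*)%C))%:E)%E.
Proof.
pose p := [seq (i, j) | i <- s, j <- s].
transitivity (\int[lebesgue_measure]_(t in `[0%R, 1%R])
     (\sum_(ij <- p) complex.Re (c ij.1 * ((c ij.2)^*)%C *
        expi ((m ij.1 - m ij.2)%:~R * t)))%:E)%E.
  apply: eq_integral => t _; congr EFin.
  rewrite sqr_normcE rmorph_sum mulr_suml (raddf_sum (@complex.Re R)).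
  rewrite big_allpairs; apply: eq_bigr => i _.
  rewrite mulr_sumr (raddf_sum (@complex.Re R)); apply: eq_bigr => j _.
  congr complex.Re.
  by rewrite rmorphM [X in _ * (_ * X)]conjc_expi intrB mulrBl expiD mulrACA.
rewrite integral_sum_Re_expi big_mkcond big_allpairs; congr EFin.
apply: eq_bigr => i _; rewrite [RHS]big_mkcond; apply: eq_bigr => j _.
by rewrite /= subr_eq0.
Qed.

Lemma Re_mul_conjc_le z1 z2 :
  complex.Re (z1 * (z2^*)%C) <= normc z1 ^+ 2 / 2 + normc z2 ^+ 2 / 2.
Proof.
rewrite !sqr_normcE; case: z1 z2 => [a b] [c d] /=.
have := sqr_ge0 (a - c); have := sqr_ge0 (b - d); nra.
Qed.

Lemma sum_fiber_le (I : eqType) (s : seq I) (c : I -> R[i]) (m : I -> int) (C : R) :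
  (forall i, i \in s -> (count (fun j => m i == m j) s)%:R <= C) ->
  \sum_(i <- s) \sum_(j <- s | m i == m j) complex.Re (c i * ((c j)^*)%C) <=
  C * \sum_(i <- s) normc (c i) ^+ 2.
Proof.
move=> sC; pose w i := normc (c i) ^+ 2.
(* By symmetry of [m i == m j], both halves of the bound can be charged to i; each [w i] is then
   counted once per element of its fiber. *)
pose S := \sum_(i <- s) \sum_(j <- s | m i == m j) w i / 2.
have SE : \sum_(i <- s) \sum_(j <- s | m i == m j) w j / 2 = S.
  rewrite /S (exchange_big_dep predT) //=.
  by apply: eq_bigr => i _; apply: eq_bigl => j; rewrite eq_sym.
apply: (@le_trans _ _ (S + S)).
  rewrite -{2}SE -big_split; apply: ler_sum => i _; rewrite -big_split.
  by apply: ler_sum => j _; exact: Re_mul_conjc_le.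
rewrite -big_split mulr_sumr big_seq [leRHS]big_seq; apply: ler_sum => i si.
rewrite /= -big_split /= -splitr big_const_seq iter_addr_0.
rewrite -mulr_natl ler_wpM2r ?sqr_ge0 //; exact: sC.
Qed.

Lemma sum_fiber_inj (I : eqType) (s : seq I) (c : I -> R[i]) (m : I -> int) :
  uniq s -> {in s &, injective m} ->
  \sum_(i <- s) \sum_(j <- s | m i == m j) complex.Re (c i * ((c j)^*)%C) =
  \sum_(i <- s) normc (c i) ^+ 2.
Proof.
move=> us injm; apply: eq_big_seq => i si; rewrite sqr_normcE.
rewrite big_mkcond (bigD1_seq i) //= eqxx big1_seq ?addr0 // => j /andP[ji sj].
by case: eqP => // mij; rewrite (injm i j si sj mij) eqxx in ji.
Qed.

(** * Finiteness of the index sets *)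

Lemma finite_int_ball (n : nat) : finite_set [set k : int | (`|k| <= n)%N].
Proof.
apply: (@sub_finite_set _ _ ((fun i : nat => i%:Z - n%:Z) @` `I_(2 * n).+1)).
  move=> k /= kn; exists `|(k + n%:Z)%R|%N; lia.
exact/finite_image/finite_II.
Qed.

(** An integer is at most its square in absolute value, so both coordinates are at most n. *)
Lemma finite_arc_points (alpha : R) (N n : nat) : finite_set (arc_points alpha N n).
Proof.
apply: (@sub_finite_set _ _
  ([set k : int | (`|k| <= n)%N] `*` [set k : int | (`|k| <= n)%N])).
  move=> [x y] [/= xyn _]; split; rewrite /=; nia.
by apply: finite_setX; exact: finite_int_ball.
Qed.

Lemma finite_int_itv (x y : R) : finite_set [set k : int | x <= k%:~R <= y].
Proof.
pose M := (Num.bound `|x| + Num.bound `|y|)%N.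
apply: (sub_finite_set _ (finite_int_ball M)) => k /= /andP[xk ky].
suff : (`|k| <= M%:Z)%R by lia.
rewrite -(ler_int R) intr_norm ler_norml.
have := archi_boundP (normr_ge0 x); have := archi_boundP (normr_ge0 y).
have := ler_norm y; have := lerNnormlW (lexx `|x|).
have := normr_ge0 x; have := normr_ge0 y.
rewrite /M -pmulrn natrD; lra.
Qed.

End Exponentials.

Theorem theorem16 (R : realType) :
  (forall alpha : R, alpha < 1 / 2 ->
     exists C : R, forall N n : nat, (0 < n)%N ->
       #|` fset_set (arc_points alpha N n)|%:R <= C) ->
  forall alpha : R, alpha < 1 ->
    exists K : R, forall (N : nat) (a : int -> R[i]), (0 < N)%N ->
      (Lpnorm01 4 (short_squares_poly alpha N a) <=
         K%:E * Lpnorm01 2 (short_squares_poly alpha N a))%E.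
Proof.
move=> arc_bound alpha alpha1.
(* With M = max(alpha, 0) < 1, 2 beta is the midpoint of M and 1. The maximum with 0 keeps beta
   positive when alpha is negative. *)
pose beta : R := (Num.max alpha 0 + 1) / 4.
have [alpha_beta beta0 beta2] :
    [/\ alpha <= 2 * beta, 0 < beta & beta < 1 / 2].
  have : alpha <= Num.max alpha 0 by rewrite le_max lexx.
  have : 0 <= Num.max alpha 0 by rewrite le_max lexx orbT.
  have : Num.max alpha 0 < 1 by rewrite gt_max alpha1 ltr01.
  by rewrite /beta; split; lra.
have [C HC] := arc_bound _ beta2.
(* Any instance of the bound will do: C dominates a cardinal. *)
have C0 : 0 <= C := le_trans (ler0n _ _) (HC 0 1 isT).
exists (C `^ 4^-1) => N a N0.
pose W : set int := [set k : int | (N%:R : R) <= k%:~R <= N%:R + N%:R `^ alpha].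
have finW : finite_set W by exact: finite_int_itv.
pose s : seq int := fset_set W.
have sW k : k \in s -> (N%:R : R) <= k%:~R <= N%:R + N%:R `^ alpha.
  by rewrite /s in_fset_set // inE.
have us : uniq s := fset_uniq _.
set f := short_squares_poly _ _ _.
have fE t : f t = \sum_(k <- s) a k * expi ((k ^+ 2)%:~R * t).
  exact: fsbig_finite.
pose B := \sum_(k <- s) normc (a k) ^+ 2.
have B0 : 0 <= B by apply: sumr_ge0 => k _; exact: sqr_ge0.
have int2 : (\int[lebesgue_measure]_(t in `[0%R, 1%R])
    (normc (f t) `^ 2)%:E)%E = B%:E.
  under eq_integral do rewrite powR_mulrn ?normc_ge0 // fE.
  rewrite integral_sqr_normc sum_fiber_inj // => j k /sW/andP[Nj _] /sW/andP[Nk _].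
  move: Nj Nk; rewrite !pmulrn !ler_int => Nj Nk /eqP.
  by rewrite eqrXn2 ?(le_trans _ Nj) ?(le_trans _ Nk) // => /eqP.
pose p := [seq (j, k) | j <- s, k <- s].
pose c (jk : int * int) := a jk.1 * a jk.2.
pose m (jk : int * int) : int := jk.1 ^+ 2 + jk.2 ^+ 2.
pose A := \sum_(i <- p) \sum_(j <- p | m i == m j) complex.Re (c i * ((c j)^*)%C).
have int4 : (\int[lebesgue_measure]_(t in `[0%R, 1%R])
    (normc (f t) `^ 4)%:E)%E = A%:E.
  rewrite -integral_sqr_normc; apply: eq_integral => t _; congr EFin.
  (* |f|^4 = |f^2|^2, and f^2 is an exponential sum over ordered pairs. *)
  rewrite powR_mulrn ?normc_ge0 // (exprD _ 2 2) -exprMn -normcM.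
  congr (normc _ ^+ 2).
  rewrite fE big_allpairs mulr_suml; apply: eq_bigr => j _.
  rewrite mulr_sumr; apply: eq_bigr => k _.
  by rewrite /c /m /= intrD mulrDl expiD mulrACA.
(* The sign is not visible on the sum of real parts, but A is the integral of |f|^4. *)
have A0 : 0 <= A.
  by rewrite -lee_fin -int4; apply: integral_ge0 => t _; rewrite lee_fin powR_ge0.
have AB : A <= C * B ^+ 2.
  have -> : B ^+ 2 = \sum_(i <- p) normc (c i) ^+ 2.
    rewrite expr2 big_allpairs mulr_suml; apply: eq_bigr => j _.
    by rewrite mulr_sumr; apply: eq_bigr => k _; rewrite normcM exprMn.
  apply: sum_fiber_le => i /allpairsP[[j k] [/= /sW/andP[Nj _] /sW/andP[Nk _] ->]].
  pose n := `|m (j, k)|%N.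
  have mn : m (j, k) = n%:Z by rewrite /n gez0_abs // addr_ge0 ?sqr_ge0.
  (* Here n >= 2 N^2 and N > 0. The strictness turns the closed window of f into the half-open one
     of the hypothesis. *)
  have N2n : (N ^ 2 < n)%N.
    by move: Nj Nk; rewrite !pmulrn !ler_int => Nj Nk; move: mn; rewrite /m /=; nia.
  apply: le_trans (HC N n (leq_ltn_trans _ N2n)) => //.
  (* The fiber is a duplicate-free list of pairs, all of them points of the arc. *)
  rewrite ler_nat -size_filter; apply: uniq_leq_size.
    by apply/filter_uniq/allpairs_uniq => // -[? ?] [? ?] _ _ [-> ->].
  move=> [x y]; rewrite mem_filter => /andP[/eqP mxy].
  case/allpairsP=> -[x' y'] /= [_ /sW/andP[Ny yN] [_ yy']].
  subst y'; rewrite in_fset_set; last exact: finite_arc_points.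
  rewrite inE; split; first by rewrite -mn mxy.
  have y0 : 0 <= y by move: Ny; rewrite !pmulrn ler_int; lia.
  rewrite /= ger0_norm // Ny /= (le_lt_trans yN) // ltrD2l.
  (* N^alpha <= N^(2 beta) = (N^2)^beta < n^beta, using N >= 1 and then beta > 0. *)
  apply: (@le_lt_trans _ _ ((N ^ 2)%:R `^ beta)).
    rewrite natrX -powR_mulrn // -powRrM ler_powR // ler1n //.
  by rewrite gt0_ltr_powR // ?nnegrE ?ltr_nat.
rewrite /Lpnorm01 int4 int2 !poweR_EFin -EFinM lee_fin.
(* Fourth roots: (C B^2)^(1/4) = C^(1/4) B^(1/2), and B^(1/2) is the L^2 norm of f. *)
apply: le_trans (ge0_ler_powR _ _ _ AB) _; rewrite ?nnegrE ?mulr_ge0 ?sqr_ge0 //.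
rewrite powRM ?sqr_ge0 // ler_wpM2l ?powR_ge0 //.
rewrite -powR_mulrn // -powRrM.
by rewrite (_ : 2 * 4^-1 = 2^-1 :> R) //; field.
Qed.
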